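(* Let $w = w(n)$ be any function tending to infinity (arbitrarily slowly), and let $f(n) = n2^{-w\cdot(\log n)^{2/3}}$. Then $\mathrm{RT}(n,\mathrm{TK}^3_6,f(n)) = o(n^3)$.
   Context: $\mathrm{RT}(n,\mathcal{H},f(n))$ is the maximum number of hyperedges in an $n$-vertex $3$-uniform hypergraph containing no copy of $\mathcal{H}$ as a subhypergraph and having independence number (maximum size of a vertex set containing no hyperedge) at most $f(n)$. $\mathrm{TK}^3_6$ is the $3$-uniform hypergraph obtained from the complete graph $K_6$ by replacing each edge $uv$ with a hyperedge $\{u,v,x_{uv}\}$ where the $x_{uv}$ are $15$ distinct new vertices. *)

(* Defs.v *)
From HB Require Import structures.
From mathcomp Require Import all_boot all_order all_algebra.
From mathcomp Require Import all_classical all_reals all_analysis.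

Set Implicit Arguments.
Unset Strict Implicit.
Unset Printing Implicit Defensive.

Import Order.TTheory GRing.Theory Num.Theory.
Import numFieldNormedType.Exports.

(* A hypergraph on the vertex type T is given by its set of hyperedges. *)
Definition hypergraph (T : finType) : Type := {set {set T}}.

Definition uniform (r : nat) (T : finType) (H : hypergraph T) : bool :=
  [forall e in H, #|e| == r].

(* Copies are not required to be induced. *)
Definition has_copy (V T : finType) (F : hypergraph V) (H : hypergraph T) :
    bool :=
  [exists phi : {ffun V -> T},
    injectiveb phi && [forall e in F, phi @: e \in H]].

Definition independent (T : finType) (H : hypergraph T) (A : {set T}) : bool :=
  [forall e in H, ~~ (e \subset A)].

Definition independence_number (T : finType) (H : hypergraph T) : nat :=
  \max_(A : {set T} | independent H A) #|A|.

(* The maximum is 0 when no hypergraph satisfies the constraints.  The bound m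
   on the independence number is real and is not rounded. *)
Definition RT (R : realType) (n : nat) (V : finType) (F : hypergraph V)
    (m : R) : nat :=
  \max_(H : {set {set 'I_n}} | [&& uniform 3 H, ~~ has_copy F H
                                & ((independence_number H)%:R <= m)%R]) #|H|.

(* The edges of the complete graph on k vertices. *)
Definition Kedge (k : nat) : finType := {e : {set 'I_k} | #|e| == 2}.

(* The vertex x_uv attached to the edge e = uv is [inr e]. *)
Definition TK3 (k : nat) : hypergraph ('I_k + Kedge k)%type :=
  [set inr e |: [set inl u | u in val e] | e : Kedge k].

(* Main.v *)
(** Call a pair of vertices heavy when its codegree is at least 36; all but
    36 n^2 hyperedges span triangles of heavy pairs.  A set larger than the
    independence number contains a hyperedge {a, b, c}, so a and b can serve as
    two branch vertices with subdivision vertex c, while heavy pairs can be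
    subdivided greedily.  It therefore suffices to find three such hyperedges
    whose pairs (a_i, b_i) are completely joined by heavy pairs.  Dependent
    random choice between vertices and pairs of vertices yields a large set U1
    in which any two vertices have at least e^(-2s) n^2 heavy pairs in their
    common link, where s = (ln n)^(1/3); a hyperedge in U1 gives a_1, b_1.  A
    second dependent random choice inside that common link yields U2, any two
    vertices of which have many common neighbours; hyperedges in U2 and in such
    a common neighbourhood give the other two pairs.  The sample sizes s^2 and
    s are what dictates the exponent 2/3. *)

Require Import Defs.
From HB Require Import structures.
From mathcomp Require Import all_boot all_order all_algebra.
From mathcomp Require Import all_classical all_reals all_analysis.
From mathcomp Require Import ring lra zify.

Set Implicit Arguments.
Unset Strict Implicit.
Unset Printing Implicit Defensive.

Import Order.TTheory GRing.Theory Num.Theory.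
Import numFieldNormedType.Exports.

(** * Double counting and dependent random choice *)

Lemma double_count (X Y : finType) (r : X -> Y -> bool) :
  \sum_x #|[set y | r x y]| = \sum_y #|[set x | r x y]|.
Proof.
under eq_bigr do rewrite -sum1_card big_mkcond.
under [RHS]eq_bigr do rewrite -sum1_card big_mkcond.
rewrite exchange_big; apply: eq_bigr => y _; apply: eq_bigr => x _.
by rewrite !inE.
Qed.

Lemma card_rel (X Y : finType) (r : X -> Y -> bool) :
  #|[set p : X * Y | r p.1 p.2]| = \sum_x #|[set y | r x y]|.
Proof.
rewrite -sum1_card big_mkcond (eq_bigr (fun p => (r p.1 p.2 : nat))); last first.
  by move=> p _; rewrite inE; case: (r _ _).
rewrite -(pair_bigA _ (fun x y => (r x y : nat))) /=; apply: eq_bigr => x _.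
rewrite -sum1_card [RHS]big_mkcond; apply: eq_bigr => y _.
by rewrite inE; case: (r _ _).
Qed.

Lemma card_ffun_in (Y : finType) (t : nat) (S : {set Y}) :
  #|[set f : {ffun 'I_t -> Y} | [forall i, f i \in S]]| = #|S| ^ t.
Proof.
rewrite -[t in RHS]card_ord -card_ffun_on; apply: eq_card => f.
by rewrite !inE; apply: eq_forallb.
Qed.

(** One endpoint of every bad pair is deleted, at a cost of at most one vertex per pair. Pairs
    [(x, x)] are counted too, so the case [x = x'] is covered. *)
Lemma delete_bad_pairs (X : finType) (N : {set X}) (bad : rel X) (u : nat) :
  u + #|[set p : X * X | [&& p.1 \in N, p.2 \in N & bad p.1 p.2]]| < #|N| ->
  exists2 U : {set X}, U \subset N & u < #|U| /\
    {in U &, forall x x', ~~ bad x x'}.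
Proof.
set B := finset _ => ltN.
exists (N :\: [set p.1 | p in B]); first exact: subsetDl.
split.
  have := cardsID [set p.1 | p in B] N.
  have : #|N :&: [set p.1 | p in B]| <= #|B|.
    by rewrite (leq_trans (subset_leq_card (subsetIr _ _)))// leq_imset_card.
  lia.
move=> x x' /setDP[xN xB] /setDP[x'N _]; apply: contra xB => xx'.
by apply/imsetP; exists (x, x') => //; rewrite !inE xN x'N.
Qed.

(* [2 * q] is a lower bound on the edge density, and [mu] is the relative
   codegree guaranteed in [U], including the case [x = x']. *)
Lemma dependent_random_choice (R : realFieldType) (X Y : finType)
    (r : X -> Y -> bool) (t u : nat) (q mu : R) :
  0 < #|Y| -> (0 <= q)%R -> (0 <= mu)%R ->
  (2 * q * #|X|%:R * #|Y|%:R <= #|[set p : X * Y | r p.1 p.2]|%:R)%R ->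
  (u%:R + #|X|%:R ^+ 2 * mu ^+ t < #|X|%:R * q ^+ t.+1)%R ->
  exists2 U : {set X}, u < #|U| & {in U &, forall x x',
    (mu * #|Y|%:R < #|[set y | r x y && r x' y]|%:R)%R}.
Proof.
move=> Y0 q0 mu0 dens hu.
pose deg x := #|[set y | r x y]|.
(* Were [A] smaller than [q |X|], its edges and the at most [q |Y|] edges at each other vertex would
   not reach density [2 q]. *)
pose A := [set x | (q * #|Y|%:R <= (deg x)%:R :> R)%R].
have YR0 : (0 < #|Y|%:R :> R)%R by rewrite ltr0n.
have cardA : (q * #|X|%:R <= #|A|%:R)%R.
  rewrite -(ler_pM2r YR0).
  have : ((\sum_x (deg x)%:R : R) <= #|A|%:R * #|Y|%:R + #|X|%:R * (q * #|Y|%:R))%R.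
    rewrite (bigID (mem A)) /=; apply: lerD.
      rewrite mulr_natl -sumr_const; apply: ler_sum => x _.
      by rewrite ler_nat max_card.
    apply: le_trans (_ : (\sum_(x | x \notin A) q * #|Y|%:R <= _)%R).
      by apply: ler_sum => x; rewrite inE -ltNge => /ltW.
    rewrite sumr_const mulr_natl; apply: ler_wpMn2l; last exact: max_card.
    by rewrite mulr_ge0 // ltW.
  by move: dens; rewrite card_rel natr_sum -/deg; lra.
pose bad x x' := (#|[set y | r x y && r x' y]|%:R <= mu * #|Y|%:R :> R)%R.
(* A sample is a [t]-tuple in [Y], repetitions allowed; expectations appear as sums over all
   samples. *)
pose F := {ffun 'I_t -> Y}.
pose N (f : F) := [set x in A | [forall i, r x (f i)]].
pose B (f : F) := [set p : X * X | [&& p.1 \in N f, p.2 \in N f & bad p.1 p.2]].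
(* If no sample is good, summing [|N f| <= u + |B f|] over all samples contradicts [hu]. *)
have [f ltN|noN] := pickP (fun f => u + #|B f| < #|N f|).
  have [U UN [uU Ubad]] := delete_bad_pairs ltN.
  by exists U => // x x' xU x'U; rewrite ltNge Ubad.
have sumN : (\sum_f #|N f|)%N = \sum_(x in A) deg x ^ t.
  rewrite -(double_count (fun x (f : F) => (x \in A) && [forall i, r x (f i)])).
  rewrite [RHS]big_mkcond; apply: eq_bigr => x _; case: (x \in A) => /=.
    rewrite -card_ffun_in; apply: eq_card => f; rewrite !inE.
    by apply: eq_forallb => i; rewrite inE.
  apply/eqP; rewrite cards_eq0 -finset.subset0.
  by apply/fintype.subsetP => f; rewrite inE.
(* A bad pair survives in [N f] only if all [t] sampled elements lie among its at most [mu |Y|]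
   common neighbours. *)
have sumB : ((\sum_f #|B f|)%:R <= #|X|%:R ^+ 2 * (mu * #|Y|%:R) ^+ t :> R)%R.
  have -> : \sum_f #|B f| = \sum_p #|[set f | p \in B f]|.
    rewrite (double_count (fun p f => p \in B f)); apply: eq_bigr => f _.
    by apply: eq_card => p; rewrite [RHS]inE.
  rewrite natr_sum.
  rewrite -natrX -mulnn -card_prod mulr_natl -sumr_const; apply: ler_sum => -[x x'] _.
  have [xx'|xx'] := boolP (bad x x'); last first.
    have -> : [set f | (x, x') \in B f] = finset.set0.
      by apply/finset.setP => f; rewrite !inE (negPf xx') !andbF.
    by rewrite cards0 exprn_ge0 ?mulr_ge0 // ltW.
  apply: le_trans (lerXn2r t _ _ xx'); rewrite ?nnegrE ?mulr_ge0 ?(ltW YR0) //.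
  rewrite -natrX -card_ffun_in ler_nat; apply/subset_leq_card/fintype.subsetP => f.
  rewrite !inE /= -!andbA => /and5P[_ /forallP rx _ /forallP rx' _].
  by apply/forallP => i; rewrite inE rx rx'.
(* One factor [q] comes from the size of [A], the other [t] from the degrees in [A]. *)
have lower : (#|X|%:R * q ^+ t.+1 * #|Y|%:R ^+ t <= (\sum_f #|N f|)%:R :> R)%R.
  rewrite sumN natr_sum exprS mulrA -mulrA -exprMn [(_%:R * q)%R]mulrC.
  apply: le_trans (_ : (#|A|%:R * (q * #|Y|%:R) ^+ t <= _)%R).
    by apply: ler_wpM2r => //; rewrite exprn_ge0 // mulr_ge0 // ltW.
  rewrite mulr_natl -sumr_const; apply: ler_sum => x; rewrite inE => xA.
  by rewrite natrX lerXn2r ?nnegrE ?mulr_ge0 ?(ltW YR0) ?ler0n.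
have upper : ((\sum_f #|N f|)%:R <= u%:R * #|Y|%:R ^+ t + (\sum_f #|B f|)%:R :> R)%R.
  rewrite -natrX -natrM -natrD ler_nat.
  have -> : u * #|Y| ^ t = \sum_(f : F) u.
    by rewrite sum_nat_const card_ffun card_ord mulnC.
  by rewrite -big_split leq_sum // => f _; rewrite leqNgt noN.
have Yt0 : (0 < #|Y|%:R ^+ t :> R)%R by rewrite exprn_gt0.
move: hu; rewrite -(ltr_pM2r Yt0) mulrDl => hu.
by move: sumB; rewrite exprMn mulrA; lra.
Qed.

(** * Codegrees and greedy embedding of subdivisions *)

Definition codegree (T : finType) (H : hypergraph T) (x y : T) : nat :=
  #|[set z | z |: [set x; y] \in H]|.

(** Each chosen element joins the forbidden set [B], so [#|B| + size s] stays constant along the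
    induction. *)
Lemma greedy_sdr (I T : finType) (c : I -> T) (C : I -> {set T})
    (s : seq I) (B : {set T}) :
  uniq s -> {in s, forall i, #|B| + size s <= #|C i|} ->
  exists2 x : I -> T, {in s &, injective x} &
    {in s, forall i, (x i \in C i) && (x i \notin B)}.
Proof.
elim: s B => [|i s IH] B /=; first by exists c.
case/andP=> is_s us hC.
have [y] : exists y, y \in C i :\: B.
  apply/set0Pn; rewrite -card_gt0; have := hC i (mem_head _ _).
  by have := cardsID B (C i); have := subset_leq_card (subsetIr (C i) B); lia.
rewrite !inE => /andP[yB yC].
have [|x xinj xC] := IH (y |: B) us.
  move=> j js; apply: leq_trans (hC j _); last by rewrite inE js orbT.
  by rewrite cardsU1 yB; lia.
have xj j : j \in s -> [/\ j != i, x j != y, x j \in C j & x j \notin B].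
  move=> js; have /andP[-> ] := xC j js; rewrite !inE negb_or => /andP[-> ->].
  by split=> //; apply: contraNneq is_s => <-.
exists (fun j => if j == i then y else x j).
  move=> j k; rewrite !inE; case: (eqVneq j i) => [->|_] /=.
    case: (eqVneq k i) => [->//|_] /= _ /xj[_ + _ _] yx.
    by rewrite -yx eqxx.
  case: (eqVneq k i) => [->|_] /= js; last by move=> ks; apply: xinj.
  by move: js => /xj[_ + _ _] _ yx; rewrite yx eqxx.
move=> j; rewrite !inE; case: eqVneq => [->|_] /= => [_|/xj[_ _ -> ->]//].
by rewrite yC.
Qed.

Lemma card_Kedge k : #|Kedge k| = 'C(k, 2).
Proof.
rewrite card_sig -[k in RHS]card_ord -card_draws.
by apply: eq_card => e; rewrite !inE.
Qed.

(* On [M] the subdivision vertices are prescribed by [c]; outside [M] they are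
   chosen greedily, hence the codegree requirement. *)
Lemma TK3_copy k (T : finType) (H : hypergraph T) (v : 'I_k -> T)
    (M : {set Kedge k}) (c : Kedge k -> T) :
  injective v -> {in M &, injective c} ->
  {in M, forall e i, c e != v i} ->
  {in M, forall e, c e |: v @: val e \in H} ->
  (forall e, e \notin M ->
    k + 'C(k, 2).*2 <= #|[set x | x |: v @: val e \in H]|) ->
  has_copy (TK3 k) H.
Proof.
move=> vinj cinj cv cH large.
(* [B] forbids the [k] branch vertices and at most ['C(k, 2)] prescribed ones; the greedy choices
   need another ['C(k, 2)], whence the doubling. *)
pose B := [set v i | i : 'I_k] :|: [set c e | e in M].
have cardB : #|B| <= k + 'C(k, 2).
  rewrite (leq_trans (leq_card_setU _ _)) // leq_add //.
    by rewrite (leq_trans (leq_imset_card _ _)) // card_ord.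
  by rewrite (leq_trans (leq_imset_card _ _)) // -card_Kedge max_card.
pose s := enum (~: M).
have us : uniq s by apply: enum_uniq.
have [|x xinj xC] := greedy_sdr (B := B) (s := s)
    (C := fun e => [set x | x |: v @: val e \in H]) c us.
  move=> e; rewrite mem_enum inE => /large; apply: leq_trans.
  rewrite -addnn addnA leq_add // -cardE -card_Kedge; exact: max_card.
have xP e : e \notin M -> [/\ x e |: v @: val e \in H,
    (forall i, x e != v i) & {in M, forall e', x e != c e'}].
  move=> eM; have /xC : e \in s by rewrite mem_enum inE.
  rewrite !inE negb_or => /and3P[-> xv xc]; split=> // [i|e' e'M].
    by apply: contraNneq xv => ->; apply: imset_f.
  by apply: contraNneq xc => ->; apply: imset_f.
pose phi (z : 'I_k + Kedge k) :=
  match z with inl i => v i | inr e => if e \in M then c e else x e end.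
apply/existsP; exists (finfun phi); apply/andP; split.
  apply/injectiveP => -[i|e] [j|e']; rewrite !ffunE /=.
  - by move/vinj => ->.
  - case: ifP => [eM /eqP|/negbT/xP[_ xv _] /eqP].
      by rewrite eq_sym (negPf (cv _ eM i)).
    by rewrite eq_sym (negPf (xv i)).
  - case: ifP => [eM /eqP|/negbT/xP[_ xv _] /eqP].
      by rewrite (negPf (cv _ eM j)).
    by rewrite (negPf (xv j)).
  - case: ifP => eM; case: ifP => e'M.
    + by move/(cinj _ _ eM e'M) => ->.
    + by have [_ _ xc] := xP _ (negbT e'M) => /eqP; rewrite eq_sym (negPf (xc _ eM)).
    + by have [_ _ xc] := xP _ (negbT eM) => /eqP; rewrite (negPf (xc _ e'M)).
    + by move/xinj => ->//; rewrite mem_enum inE ?eM ?e'M.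
apply/forallP => E; apply/implyP => /imsetP[e _ ->].
rewrite imsetU1 ffunE /= -imset_comp.
rewrite (eq_imset (g := v)); last by move=> i; rewrite /= ffunE.
by case: ifP => [/cH//|/negbT/xP[]].
Qed.

(* The branch vertices come in consecutive pairs [2i, 2i+1] of [core]; such a
   pair is subdivided by the [i]-th entry of [cs]. *)
Lemma TK3_copy_matched m (T : finType) (H : hypergraph T) (x0 : T)
    (core cs : seq T) :
  size core = m.*2 -> size cs = m -> uniq (core ++ cs) ->
  (forall i, i < m ->
    nth x0 cs i |: [set nth x0 core i.*2; nth x0 core i.*2.+1] \in H) ->
  (forall i j, i < m.*2 -> j < m.*2 -> i./2 != j./2 ->
    m.*2 + 'C(m.*2, 2).*2 <= codegree H (nth x0 core i) (nth x0 core j)) ->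
  has_copy (TK3 m.*2) H.
Proof.
move=> szcore szcs; rewrite cat_uniq => /and3P[ucore disj ucs] hedge large.
pose v (i : 'I_m.*2) := nth x0 core i.
(* The index is read off an arbitrary endpoint; it is well defined only on the matching [M], where
   both endpoints have the same half. *)
pose half_of (e : Kedge m.*2) :=
  if [pick i in val e] is Some i then (nat_of_ord i)./2 else 0.
pose M := [set e : Kedge m.*2 |
  [forall i in val e, forall j in val e, (nat_of_ord i)./2 == (nat_of_ord j)./2]].
have elems (e : Kedge m.*2) :
    exists i j : 'I_m.*2, i < j /\ val e = [set i; j].
  have /cards2P[i [j [ij eij]]] := valP e.
  case: (ltngtP i j) => [lt|gt|eq]; first by exists i, j.
    by exists j, i; rewrite finset.setUC.
  by move: ij; rewrite (ord_inj eq) eqxx.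
have half_M e i : e \in M -> i \in val e -> half_of e = (nat_of_ord i)./2.
  rewrite inE /half_of => /forall_inP eM ie.
  case: pickP => [j je|/(_ i)]; last by rewrite ie.
  by apply/eqP; move/forall_inP: (eM j je); apply.
have M_elems e : e \in M -> exists i j : 'I_m.*2,
    [/\ val e = [set i; j], nat_of_ord i = (half_of e).*2,
        nat_of_ord j = (half_of e).*2.+1 & half_of e < m].
  move=> eM; have [i [j [ij eij]]] := elems e; exists i, j.
  have hi : half_of e = (nat_of_ord i)./2 by apply: half_M; rewrite // eij !inE eqxx.
  have hj : half_of e = (nat_of_ord j)./2.
    by apply: half_M; rewrite // eij !inE eqxx orbT.
  by split=> //; move: (ltn_ord i) (ltn_ord j); lia.
apply: (@TK3_copy _ _ _ v M (fun e => nth x0 cs (half_of e))).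
- move=> i j /eqP; rewrite /v nth_uniq ?szcore // => /eqP; exact: ord_inj.
- move=> e e' eM e'M /eqP.
  have [i [j [eij hi hj he]]] := M_elems e eM.
  have [i' [j' [eij' hi' hj' he']]] := M_elems e' e'M.
  rewrite nth_uniq ?szcs // => /eqP hee; apply: val_inj; rewrite eij eij'.
  by congr [set _; _]; apply: ord_inj; rewrite ?hi ?hi' ?hj ?hj' hee.
- move=> e eM i; have [_ [_ [_ _ _ he]]] := M_elems e eM.
  apply: contraNneq disj => ci; apply/hasP; exists (nth x0 cs (half_of e)).
    by rewrite mem_nth ?szcs.
  by rewrite ci mem_nth ?szcore.
- move=> e eM; have [i [j [-> hi hj he]]] := M_elems e eM.
  by rewrite imsetU1 imset_set1 /v hi hj; apply: hedge.
- move=> e eM; have [i [j [ij eij]]] := elems e.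
  rewrite eij imsetU1 imset_set1; apply: large => //.
  apply: contra eM => /eqP hij; rewrite inE eij.
  by apply/forall_inP => a; rewrite !inE => /orP[]/eqP->;
    apply/forall_inP => b; rewrite !inE => /orP[]/eqP->; rewrite ?hij.
Qed.

(** * Hyperedges in large sets, heavy triangles and the copy of [TK3 6] *)

Lemma cards3P (T : finType) (e : {set T}) : #|e| = 3 ->
  exists a b c, [/\ a != b, a != c, b != c & e = c |: [set a; b]].
Proof.
move=> e3; have [c ce] : exists c, c \in e by apply/set0Pn; rewrite -card_gt0 e3.
have /eqP/cards2P[a [b [ab eab]]] : #|e :\ c| = 2.
  by have := cardsD1 c e; rewrite e3 ce => -[].
have cab : c \notin [set a; b] by rewrite -eab !inE eqxx.
exists a, b, c; rewrite -eab finset.setD1K //; move: cab; rewrite !inE negb_or.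
by case/andP=> ca cb; split; rewrite // eq_sym.
Qed.

Lemma large_set_hyperedge (T : finType) (H : hypergraph T) (A : {set T}) :
  uniform 3 H -> independence_number H < #|A| ->
  exists a b c, [/\ a \in A, b \in A & c \in A] /\
    [/\ a != b, a != c, b != c & c |: [set a; b] \in H].
Proof.
move=> /forall_inP uH ltA.
have : ~~ independent H A.
  by apply: contraL ltA => indA; rewrite -leqNgt; apply: leq_bigmax_cond.
case/forall_inPn => e eH; rewrite negbK => eA.
have [a [b [c [ab ac bc eE]]]] := cards3P (eqP (uH e eH)).
exists a, b, c; rewrite -eE; split; last by split.
by split; apply: (fintype.subsetP eA); rewrite eE !inE eqxx ?orbT.
Qed.

Lemma codegreeC (T : finType) (H : hypergraph T) x y :
  codegree H x y = codegree H y x.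
Proof. by rewrite /codegree finset.setUC. Qed.

Lemma codegree_diag (T : finType) (H : hypergraph T) x :
  uniform 3 H -> codegree H x x = 0.
Proof.
move=> /forall_inP uH; apply/eqP; rewrite cards_eq0 -finset.subset0.
apply/fintype.subsetP => z; rewrite !inE => /uH.
by rewrite finset.setUid cardsU1 cards1; case: (_ \notin _).
Qed.

Lemma card_low_codegree (T : finType) (H : hypergraph T) (K : nat) :
  #|[set p : (T * T) * T | (codegree H p.1.1 p.1.2 < K)
      && (p.2 |: [set p.1.1; p.1.2] \in H)]| <= K * #|T| ^ 2.
Proof.
rewrite (card_rel (fun (p : T * T) z => (codegree H p.1 p.2 < K)
  && (z |: [set p.1; p.2] \in H))).
apply: (@leq_trans (\sum_(p : T * T) K)); last by rewrite sum_nat_const card_prod mulnC.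
apply: leq_sum => -[x y] _ /=; case: ltnP => [lt|_] /=; first exact: ltnW.
by rewrite (_ : [set _ | false] = finset.set0) ?cards0.
Qed.

(** Every hyperedge arises from an ordered heavy triangle or from a light pair with a third vertex;
    [card_low_codegree] counts the latter. *)
Lemma card_le_triangles (T : finType) (H : hypergraph T) (K : nat) :
  uniform 3 H ->
  #|H| <= #|[set p : T * (T * T) | [&& K <= codegree H p.1 p.2.1,
      K <= codegree H p.1 p.2.2 & K <= codegree H p.2.1 p.2.2]]|
    + K * #|T| ^ 2.
Proof.
move=> /forall_inP uH; set A := finset _.
have := card_low_codegree H K; set B := finset _ => leB.
pose F (p : T * (T * T)) := p.2.2 |: [set p.1; p.2.1].
pose F' (p : (T * T) * T) := p.2 |: [set p.1.1; p.1.2].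
apply: (@leq_trans #|(F @: A) :|: (F' @: B)|); last first.
  apply: leq_trans (leq_card_setU _ _) _.
  by rewrite leq_add ?leq_imset_card // (leq_trans (leq_imset_card _ _)).
apply/subset_leq_card/fintype.subsetP => e eH.
have [a [b [c [_ _ _ eE]]]] := cards3P (eqP (uH e eH)).
have low x y z : e = z |: [set x; y] -> codegree H x y < K -> e \in F' @: B.
  move=> exyz xy; rewrite exyz (_ : _ |: _ = F' ((x, y), z)) //.
  by apply: imset_f; rewrite inE /= xy -exyz.
rewrite inE; case: (ltnP (codegree H a b) K) => [/(low _ _ _ eE)->|ab].
  by rewrite orbT.
case: (ltnP (codegree H a c) K) => [|ac].
  move=> /(low a c b) ->; rewrite ?orbT // eE.
  by apply/finset.setP => z; rewrite !inE; case: (z == a); case: (z == b); case: (z == c).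
case: (ltnP (codegree H b c) K) => [|bc].
  move=> /(low b c a) ->; rewrite ?orbT // eE.
  by apply/finset.setP => z; rewrite !inE; case: (z == a); case: (z == b); case: (z == c).
rewrite eE (_ : _ |: _ = F (a, (b, c))) // imset_f // inE /=.
by rewrite ab ac bc.
Qed.

(** Discarding the pairs through [c] costs only a linear term; this keeps the first subdivision
    vertex out of later choices. *)
Lemma card_pairs_avoiding (T : finType) (P : {pred T * T}) (c : T) :
  #|[set p | P p]| <=
    #|[set p | [&& P p, p.1 != c & p.2 != c]]| + (#|T|).*2.
Proof.
pose S1 := [set (c, z) | z : T]; pose S2 := [set (z, c) | z : T].
apply: (@leq_trans #|[set p | [&& P p, p.1 != c & p.2 != c]] :|: (S1 :|: S2)|).
  apply/subset_leq_card/fintype.subsetP => -[y z]; rewrite !inE /= => -> /=.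
  case: eqVneq => [->|_] /=; first by rewrite imset_f ?orbT.
  by case: eqVneq => [->|_] //=; rewrite [X in _ || X]imset_f ?orbT.
apply: leq_trans (leq_card_setU _ _) _; rewrite leq_add2l.
apply: leq_trans (leq_card_setU _ _) _; rewrite -addnn.
by rewrite leq_add // leq_imset_card.
Qed.

(* [36 = 6 + 2 * 15] is the codegree required by [TK3_copy_matched]. *)
Lemma TK3_6_copy (R : realFieldType) (T : finType) (H : hypergraph T)
    (t1 t2 : nat) (q1 mu1 q2 mu2 : R) :
  let n : R := #|T|%:R%R in let al : R := (independence_number H)%:R%R in
  uniform 3 H -> (0 <= q1)%R -> (0 <= mu1)%R -> (0 <= q2)%R -> (0 <= mu2)%R ->
  (2 * q1 * n ^+ 3 + 36 * n ^+ 2 <= #|H|%:R)%R ->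
  (al + n ^+ 2 * mu1 ^+ t1 < n * q1 ^+ t1.+1)%R ->
  (2 * q2 * n ^+ 2 + 2 * n <= mu1 * n ^+ 2)%R ->
  (al + n ^+ 2 * mu2 ^+ t2 < n * q2 ^+ t2.+1)%R ->
  (al + 1 <= mu2 * n)%R ->
  has_copy (TK3 6) H.
Proof.
move=> n al uH q1_ge0 mu1_ge0 q2_ge0 mu2_ge0 dense h1 h2 h3 h4.
have T0 : 0 < #|T|.
  rewrite lt0n; apply/eqP => T0; move: h1; rewrite /n T0 expr0n /= !mul0r addr0.
  by rewrite ltNge ler0n.
pose G x y := 36 <= codegree H x y.
have Gsym x y : G x y = G y x by rewrite /G codegreeC.
have Gneq x y : G x y -> x != y.
  by rewrite /G => xy; apply: contraTneq xy => ->; rewrite codegree_diag.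
pose r x (p : T * T) := [&& G x p.1, G x p.2 & G p.1 p.2].
have [|||||U1 U1large U1P] := @dependent_random_choice R T (T * T)%type r t1
    (independence_number H) q1 mu1 => //.
  by rewrite card_prod muln_gt0 T0.
  have := card_le_triangles 36 uH : #|H| <= #|[set p | r p.1 p.2]| + 36 * #|T| ^ 2.
  rewrite -(ler_nat R) natrD natrM natrX -/n card_prod natrM -/n.
  by move: dense; rewrite exprS expr2; lra.
have [a1 [b1 [c1 [[a1U b1U _] [ab1 ac1 bc1 e1]]]]] := large_set_hyperedge uH U1large.
have := U1P _ _ a1U b1U; rewrite card_prod natrM -/n.
set L := #|_| => Llarge.
pose r2 y z := [&& r a1 (y, z) && r b1 (y, z), y != c1 & z != c1].
have L2 : (L <= #|[set p : T * T | r2 p.1 p.2]| + (#|T|).*2)%N.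
  apply: leq_trans (card_pairs_avoiding (fun p => r a1 p && r b1 p) c1) _.
  by rewrite leq_add2r; apply: eq_leq; apply: eq_card => -[y z]; rewrite !inE.
have [|||||U2 U2large U2P] := @dependent_random_choice R T T r2 t2
    (independence_number H) q2 mu2 => //.
  move: L2; rewrite -(ler_nat R) natrD -muln2 natrM -/n.
  by move: Llarge h2; rewrite !expr2; lra.
have [a2 [b2 [c2 [[a2U b2U c2U] [ab2 ac2 bc2 e2]]]]] := large_set_hyperedge uH U2large.
have al1 : (al + 1 < (#|[set z | r2 a2 z && r2 b2 z]|)%:R :> R)%R.
  by have := U2P _ _ a2U b2U; rewrite -/n; lra.
(* [U2P] at the diagonal pair [(c2, c2)] gives [c2] a neighbour in [r2], so [c2] differs from [c1]
   and is heavy with [a1] and [b1]. *)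
have c2nbr : exists z, r2 c2 z.
  have : 0 < #|[set z | r2 c2 z && r2 c2 z]|.
    have := U2P _ _ c2U c2U; rewrite -(ltr0n R); apply: le_lt_trans.
    by rewrite mulr_ge0.
  by rewrite card_gt0 => /set0Pn[z]; rewrite inE andbb; exists z.
(* Removing [c2] makes the third hyperedge avoid it; this is the reason for the [+ 1] in [h4]. *)
have W : (independence_number H < #|[set z | r2 a2 z && r2 b2 z] :\ c2|)%N.
  move: al1; rewrite natr1 ltr_nat (cardsD1 c2).
  by case: (_ \in _); [rewrite add1n ltnS | rewrite add0n => /ltnW].
have [a3 [b3 [c3 [[]]]]] := large_set_hyperedge uH W.
rewrite !inE /r2 /r /= => /and3P[a3c2 ra3 rb3] /and3P[b3c2 ra3' rb3'].
move=> /and3P[c3c2 rc3 rc3'] [ab3 ac3 bc3 e3].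
case: c2nbr => z /and3P[/andP[/and3P[a1c2 _ _] /and3P[b1c2 _ _]] c2c1 _].
move: ra3 => /and3P[/andP[/and3P[a1a2 a1a3 a2a3] /and3P[b1a2 b1a3 _]] a2c1 a3c1].
move: rb3 => /and3P[/andP[/and3P[a1b2 _ b2a3] /and3P[b1b2 _ _]] b2c1 _].
move: ra3' => /and3P[/andP[/and3P[_ a1b3 a2b3] /and3P[_ b1b3 _]] _ b3c1].
move: rb3' => /and3P[/andP[/and3P[_ _ b2b3] _] _ _].
move: rc3 => /and3P[/andP[/and3P[_ a1c3 a2c3] /and3P[_ b1c3 _]] _ c3c1].
have b2c3 : G b2 c3 by move: rc3' => /and3P[/andP[/and3P[_ _ ->]]].
apply: (@TK3_copy_matched 3 _ _ a1 [:: a1; b1; a2; b2; a3; b3] [:: c1; c2; c3]) => //.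
(* Distinctness comes from the three hyperedges, from the exclusion of [c1] and [c2], and otherwise
   from heaviness through [Gneq]. *)
- rewrite /= !inE !negb_or ab1 ac1 bc1 ab2 ac2 bc2 ab3 ac3 bc3 a2c1 b2c1 a3c1 b3c1.
  rewrite a3c2 b3c2 !(eq_sym c1) (eq_sym c2 c3) c2c1 c3c1 c3c2.
  by rewrite !Gneq.
- by case=> [|[|[|]]].
- move=> i j i6 j6; rewrite (_ : _ + _ = 36) // -/(G _ _).
  case: i i6 => [|[|[|[|[|[|i]]]]]] // _; case: j j6 => [|[|[|[|[|[|j]]]]]] // _ //= _;
  by rewrite Gsym.
Qed.

(** * Choice of parameters and asymptotics *)

Local Open Scope classical_set_scope.
Local Open Scope ring_scope.

(** After division by [expR L], each summand on the left is at most [expR (- Z - 1)], the right side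
    is at least [expR (- Z)], and [2 < e]. *)
Lemma sum_expR_lt (R : realType) (L A B C Z q : R) (t : nat) :
  Z + 1 <= A -> L + Z + 1 <= B * t%:R -> C * t.+1%:R <= Z -> expR (- C) <= q ->
  expR L * expR (- A) + expR L ^+ 2 * expR (- B) ^+ t < expR L * q ^+ t.+1.
Proof.
move=> hA hB hC hq.
rewrite expr2 -mulrA -mulrDr ltr_pM2l ?expR_gt0 // -expRM_natr -expRD.
apply: lt_le_trans (_ : expR (- Z) <= _); last first.
  apply: le_trans (_ : expR (- C) ^+ t.+1 <= _).
    by rewrite -expRM_natr ler_expR; lra.
  by rewrite lerXn2r // nnegrE; [exact: expR_ge0|exact: le_trans (expR_ge0 _) hq].
apply: le_lt_trans (_ : expR (- Z - 1) + expR (- Z - 1) < _).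
  by rewrite lerD // ler_expR; lra.
have -> : expR (- Z) = expR 1 * expR (- Z - 1) by rewrite -expRD; congr expR; ring.
rewrite -mulr2n -mulr_natl ltr_pM2r ?expR_gt0 //.
exact: expR_gt1Dx (oner_neq0 R).
Qed.

Lemma independence_number_gt0 (T : finType) (H : hypergraph T) :
  (0 < #|T|)%N -> uniform 3 H -> (0 < independence_number H)%N.
Proof.
move=> /card_gt0P[x _] /forall_inP uH.
have ind : independent H [set x]%SET.
  apply/forall_inP => e /uH /eqP e3; apply/negP => /subset_leq_card.
  by rewrite e3 cards1.
have := @leq_bigmax_cond _ (independent H) (fun A : {set T} => #|A|) _ ind.
by rewrite cards1.
Qed.

(* Here [s = (ln n)^(1/3)].  The first sample has size about [s^2] and keeps
   common links of density [expR (- 2 s)]; the second has size about [s]. *)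
Lemma TK3_6_copy_asymptotic (R : realType) (T : finType) (H : hypergraph T)
    (lam s eps : R) :
  0 <= lam -> 3 + lam <= s -> expR (- lam) <= eps / 4 ->
  #|T|%:R = expR (s ^+ 3) -> 72 <= eps * #|T|%:R ->
  uniform 3 H -> eps * #|T|%:R ^+ 3 <= #|H|%:R ->
  (independence_number H)%:R + 1 <= expR (- ((3 * lam + 10) * s ^+ 2)) * #|T|%:R ->
  has_copy (TK3 6) H.
Proof.
set M := 3 * lam + 10; move=> lam0 hs hlam hn epsn uH dense small.
have s0 : 0 <= s by lra.
have eps0 : 0 < eps / 4 by exact: lt_le_trans (expR_gt0 _) hlam.
have /andP[t1lb t1ub] := truncn_itv (exprn_ge0 2 s0).
have /andP[t2lb t2ub] := truncn_itv s0.
move: small hn dense epsn; set n : R := #|T|%:R => small hn dense epsn.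
have n0 : 0 < n by rewrite hn expR_gt0.
have s23 : 3 * s <= s ^+ 2 by rewrite expr2 ler_wpM2r //; lra.
have s2l : (3 + lam) * s <= s ^+ 2 by rewrite expr2 ler_wpM2r.
have s33 : (3 + lam) * s ^+ 2 <= s ^+ 3 by rewrite [s ^+ 3]exprS ler_wpM2r ?exprn_ge0.
(* Floor plus one ensures [t1 >= s^2] and [t2 >= s], with an excess of at most one. *)
pose t1 := (Num.truncn (s ^+ 2)).+1; pose t2 := (Num.truncn s).+1.
have ls2 : 0 <= lam * s ^+ 2 by rewrite mulr_ge0 ?exprn_ge0.
have al_le : (independence_number H)%:R <= n * expR (- (M * s ^+ 2)) by rewrite mulrC; lra.
have t1le : t1%:R <= s ^+ 2 + 1 by rewrite /t1 -natr1; lra.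
have t2le : t2%:R <= s + 1 by rewrite /t2 -natr1; lra.
apply: (@TK3_6_copy _ _ _ t1 t2 (eps / 4) (expR (- (2 * s))) (expR (- (3 * s)))
          (expR (- (M * s ^+ 2)))); rewrite ?expR_ge0 ?(ltW eps0) -/n //.
(* Half of [eps n^3] pays for [2 q1 n^3], the other half for [36 n^2]. *)
- have : 72 * n ^+ 2 <= eps * n * n ^+ 2 by rewrite ler_pM2r // exprn_gt0.
  by move: dense; rewrite !exprS expr0; lra.
- apply: le_lt_trans (lerD al_le (lexx _)) _.
  (* [Z] comes from [t1 + 1 <= s^2 + 2]. As [t1 >= s^2] and [n = expR (s^3)], the bad-pair term
     [n^2 mu1^t1] is at most 1. *)
  rewrite hn; apply: (@sum_expR_lt _ _ _ _ lam (lam * (s ^+ 2 + 2))) => //.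
  + by rewrite /M; nra.
  + have : 2 * s * s ^+ 2 <= 2 * s * t1%:R by rewrite ler_wpM2l ?mulr_ge0 // ltW.
    by rewrite -mulrA -exprS; nra.
  + by rewrite ler_wpM2l // -natr1; lra.
- have e3 : 4 <= expR s by apply: le_trans (expR_ge1Dx s); lra.
  have e2n : 4 * expR (- (3 * s)) <= expR (- (2 * s)).
    have -> : - (2 * s) = s + - (3 * s) by ring.
    by rewrite expRD ler_pM2r ?expR_gt0.
  have : 1 <= expR (- (3 * s)) * n.
    by rewrite hn -expRD -[leLHS]expR0 ler_expR; lra.
  rewrite expr2 -(ler_pM2r n0) => e3n.
  by have := ler_wpM2r (ltW (mulr_gt0 n0 n0)) e2n; lra.
- apply: le_lt_trans (lerD al_le (lexx _)) _.
  (* Sampling at most [s + 1] vertices at density [expR (- 3 s)] costs an exponent [3 s (s + 2)],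
     which [M s^2] dominates. *)
  rewrite hn; apply: (@sum_expR_lt _ _ _ _ (3 * s) (3 * s * (s + 2))) => //.
  + by rewrite /M -mulrA mulrDr -expr2; nra.
  + have : M * s ^+ 2 * s <= M * s ^+ 2 * t2%:R.
      by rewrite ler_wpM2l ?mulr_ge0 ?exprn_ge0 ?(ltW t2ub) // /M; lra.
    rewrite -mulrA -exprSr /M -[3 * s * _]mulrA mulrDr -expr2.
    have : 0 <= lam * s ^+ 3 by rewrite mulr_ge0 ?exprn_ge0.
    nra.
  + by rewrite ler_wpM2l ?mulr_ge0 // -natr1; lra.
Qed.

Theorem theorem2p7 (R : realType) (w f : nat -> R)
  (hw : w n @[n --> \oo] --> +oo)
  (hf : forall n : nat, f n = n%:R * 2 `^ (- (w n * ln n%:R `^ (2 / 3)))) :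
  (fun n : nat => (RT n (TK3 6) (f n))%:R : R^o) =o_\oo
  (fun n : nat => n%:R ^+ 3 : R^o).
Proof.
apply/eqoP => eps eps0.
(* This gives [expR (- lam) <= eps / 4]; the absolute value keeps [lam] nonnegative when
   [eps > 4]. *)
pose lam : R := `|ln (eps / 4)|; pose M := 3 * lam + 10.
have lam0 : 0 <= lam by exact: normr_ge0.
have ln2 : 0 < ln 2 :> R by rewrite ln_gt0 // ltr1n.
near=> n.
have npos : (0 < n)%N by near: n; exact: nbhs_infty_gt.
(* The surplus 1 beyond [M] absorbs a factor [2 <= expR 1], since [s^2 >= 1]. *)
have wn : (M + 1) / ln 2 <= w n by near: n; move/cvgryPge: hw; apply.
have epsn : 72 / eps <= n%:R by near: n; exact: nbhs_infty_ger.
have sn : expR ((3 + lam) ^+ 3) <= n%:R by near: n; exact: nbhs_infty_ger.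
have nR : 0 < n%:R :> R by rewrite ltr0n.
rewrite !ger0_norm ?exprn_ge0 ?ler0n //.
apply: (big_ind (fun m : nat => (m%:R : R) <= eps * n%:R ^+ 3)).
- by rewrite mulr_ge0 ?exprn_ge0 // ltW.
- by move=> x y; case: (leqP x y).
move=> H /and3P[uH noH indH]; rewrite leNgt; apply: contraNN noH => dense.
pose s : R := ln n%:R `^ 3^-1.
have lnn : (3 + lam) ^+ 3 <= ln n%:R.
  by rewrite -ler_expR lnK ?posrE.
have lnn0 : 0 <= ln n%:R :> R by apply: le_trans lnn; rewrite exprn_ge0; lra.
have s0 : 0 <= s by exact: powR_ge0.
have s3 : s ^+ 3 = ln n%:R.
  by rewrite -powR_mulrn // /s -powRrM mulVf ?powRr1.
have s2 : s ^+ 2 = ln n%:R `^ (2 / 3).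
  by rewrite -powR_mulrn // /s -powRrM mulrC.
have hs : 3 + lam <= s.
  by rewrite -(@ler_pXn2r _ 3) ?nnegrE ?s3 // addr_ge0.
apply: (@TK3_6_copy_asymptotic R _ H lam s eps); rewrite ?card_ord //.
- rewrite -[leRHS]lnK ?posrE ?divr_gt0 // ler_expR /lam.
  exact: lerNnormlW.
- by rewrite s3 lnK ?posrE.
- by rewrite mulrC -ler_pdivrMr.
- exact: ltW.
have ind1 : 1 <= (independence_number H)%:R :> R.
  by rewrite ler1n independence_number_gt0 // card_ord.
(* The independence number is at least 1, so adding 1 at most doubles it. *)
apply: (@le_trans _ _ (2 * f n)); first by move: indH; lra.
rewrite hf -s2 -/M mulrCA mulrC ler_pM2r //.
rewrite /powR (gt_eqF (ltr0n _ 2)).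
have e1 : 2 <= expR 1 :> R by apply: le_trans (expR_ge1Dx _).
apply: le_trans (_ : expR 1 * expR (- (w n * s ^+ 2) * ln 2) <= _).
  by rewrite ler_pM2r ?expR_gt0.
rewrite -expRD ler_expR.
have s21 : 1 <= s ^+ 2 by rewrite exprn_ege1 //; lra.
move: wn; rewrite ler_pdivrMr // => /(ler_wpM2r (le_trans ler01 s21)); lra.
Unshelve. all: by end_near. Qed.
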